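(* Let $K$ be an abelian group and let $\mathfrak g=\bigoplus_{i\in\mathbb Z}\mathfrak g^i$ be a differential graded Lie algebra over $\mathbb C$ with a compatible momentum grading $\mathfrak g=\bigoplus_{k\in K}\mathfrak g_k$ (see context), with homology $\mathfrak h=\bigoplus_{k\in K}\mathfrak h_k$, $\mathfrak h_k=H(\mathfrak g_k)$. Let $n\ge 2$ and let $(k_1,\dots,k_n)\in K^n$ be such that $\mathfrak h_{k_J}=0$ for every subset $J\subset\{1,\dots,n\}$ with $1<|J|<n$, where $k_J=\sum_{i\in J}k_i$. Then the restriction of the $n$-slot minimal model bracket $\{-,\dots,-\}_h$ to $$\mathfrak h_{k_1}\otimes\cdots\otimes\mathfrak h_{k_n}\to\mathfrak h_{k_1+\dots+k_n}$$ is the same for all momentum-conserving homotopies $h$ of $d$ satisfying $dhd=d$.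
   Context: A momentum grading is a decomposition $\mathfrak g=\bigoplus_{k\in K}\mathfrak g_k$ (algebraic direct sum) respecting the $\mathbb Z$-grading with $d\mathfrak g_k\subset\mathfrak g_k$ and $[\mathfrak g_{k_1},\mathfrak g_{k_2}]\subset\mathfrak g_{k_1+k_2}$. A homotopy for $d$ is an endomorphism $h$ of degree $-1$ with $h^2=0$, $hdh=h$; it is momentum conserving if $h\mathfrak g_k\subset\mathfrak g_k$ for all $k$. Given a homotopy with $dhd=d$, put $\pi=1-dh-hd$; then $\operatorname{im}\pi$ is a complement of $\operatorname{im}d$ in $\ker d$ and is canonically identified with $\mathfrak h$, giving maps $i:\mathfrak h\to\mathfrak g$, $p:\mathfrak g\to\mathfrak h$ of degree $0$ with $pi=1$, $ip=\pi$. Trees: $T_n$ is the set of trees with $n+1$ labeled leaves ($1,\dots,n$ inputs, $n+1$ output), $n-2$ unlabeled internal lines and $n-1$ internal nodes of degree 3; $P_n$ is the set of such trees with a planar embedding. For $P\in P_n$ define $m_{P,h}\in\operatorname{Hom}^{2-n}(\mathfrak h^{\otimes n},\mathfrak h)$: decorate each input leaf by $i$, the output leaf by $p$, each internal line by $h$, each node by $[\![x,y]\!]=(-1)^{|x|}[x,y]$; insert $x_j\in\mathfrak h$ at input $j$ and compose; multiply by the sign of the permutation that puts $x_1,\dots,x_n$ into the order in which the input labels of $P$ are read counterclockwise starting just left of the output, where for this permutation an even $x_j$ counts as odd and an odd one as even; finally multiply by $(-1)^{|x_{n-1}|+|x_{n-3}|+|x_{n-5}|+\cdots}$. This is independent of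 the planar embedding, giving $m_{T,h}$ for $T\in T_n$. The minimal model bracket is $\{-,\dots,-\}_h=\sum_{T\in T_n}m_{T,h}\in\operatorname{Hom}^{2-n}(\mathfrak h^{\otimes n},\mathfrak h)$. *)

(* Defs.v *)
From HB Require Import structures.
From mathcomp Require Import all_boot all_order all_algebra.
From mathcomp Require Import complex.
From mathcomp Require Import reals.

Set Implicit Arguments.
Unset Strict Implicit.
Unset Printing Implicit Defensive.

Import Order.TTheory GRing.Theory Num.Theory.
Local Open Scope ring_scope.

Definition sgn (C : pzRingType) (e : int) : C := (-1) ^+ `|e|%N.

(* The Z-grading and the K-grading together form a bigrading               *)
(*   g = (+)_{(i,k)} g^i_k,   g^i_k = g^i /\ g_k,                            *)
(* given by the family of projections pr i k onto g^i_k (algebraic direct   *)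
(* sum: every vector has finitely many nonzero components and is their sum). *)
Section DGLA.
Variables (C : pzRingType) (K : zmodType) (V : lmodType C).
Variables (d : V -> V) (br : V -> V -> V) (pr : int -> K -> V -> V).

Definition bihom (i : int) (k : K) (v : V) : Prop := pr i k v = v.

Definition is_linear (f : V -> V) : Prop :=
  forall (c : C) (u v : V), f (c *: u + v) = c *: f u + f v.

Definition is_momentum_dgla : Prop :=
  [/\
      (forall i k, is_linear (pr i k)),
      (forall i k j l v, pr i k (pr j l v) =
                         if (i == j) && (k == l) then pr i k v else 0),
      (forall v, exists s : seq (int * K),
           uniq s /\ v = \sum_(ik <- s) pr ik.1 ik.2 v),
      [/\ is_linear d,
          (forall i k v, bihom i k v -> bihom (i + 1) k (d v)) &
          (forall v, d (d v) = 0)] &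
      [/\ ((forall c x y z, br (c *: x + y) z = c *: br x z + br y z) /\
           (forall c x y z, br z (c *: x + y) = c *: br z x + br z y)),
          (forall i k j l x y, bihom i k x -> bihom j l y ->
              bihom (i + j) (k + l) (br x y)),
          (forall i k j l x y, bihom i k x -> bihom j l y ->
              br x y = - (sgn C (i * j) *: br y x)),
          (forall i k j l m q x y z, bihom i k x -> bihom j l y -> bihom m q z ->
              br x (br y z) = br (br x y) z + sgn C (i * j) *: br y (br x z)) &
          (forall i k j l x y, bihom i k x -> bihom j l y ->
              d (br x y) = br (d x) y + sgn C i *: br x (d y))]].

Definition acyclic_at (k : K) : Prop :=
  forall i v, bihom i k v -> d v = 0 -> exists w, bihom (i - 1) k w /\ d w = v.

Definition good_homotopy (h : V -> V) : Prop :=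
  [/\ is_linear h,
      (forall i k v, bihom i k v -> bihom (i - 1) k (h v)),
      (forall v, h (h v) = 0),
      (forall v, h (d (h v)) = h v) &
      (forall v, d (h (d v)) = d v)].

Definition piH (h : V -> V) (v : V) : V := v - d (h v) - h (d v).

End DGLA.

(* Planar rooted binary trees with input leaves labelled by naturals        *)
(* (label j stands for input j+1); the root is the node adjacent to the     *)
(* output leaf; in Node l r, l is the left input of the node.              *)
Inductive tree := Leaf of nat | Node of tree & tree.

Fixpoint tree_eqb (t u : tree) : bool :=
  match t, u with
  | Leaf a, Leaf b => a == b
  | Node l r, Node l' r' => tree_eqb l l' && tree_eqb r r'
  | _, _ => false
  end.

Lemma tree_eqP : Equality.axiom tree_eqb.
Proof.
elim=> [a|l IHl r IHr] [b|l' r'] /=; try by constructor.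
  by apply: (iffP eqP) => [->|[]].
apply: (iffP andP) => [[/IHl-> /IHr->]//|[<- <-]].
by split; [apply/IHl|apply/IHr].
Qed.

HB.instance Definition _ := hasDecEq.Build tree tree_eqP.

Fixpoint leaves (t : tree) : seq nat :=
  match t with Leaf j => [:: j] | Node l r => leaves l ++ leaves r end.

Fixpoint minleaf (t : tree) : nat :=
  match t with Leaf j => j | Node l r => minn (minleaf l) (minleaf r) end.

(* canonical planar embedding: at each node the subtree containing the
   smaller label is on the left *)
Fixpoint canon (t : tree) : bool :=
  match t with
  | Leaf _ => true
  | Node l r => [&& canon l, canon r & (minleaf l < minleaf r)%N]
  end.

(* t represents an element of T_n (via its canonical planar embedding) *)
Definition is_Tn (n : nat) (t : tree) : bool :=
  perm_eq (leaves t) (iota 0 n) && canon t.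

Fixpoint trees_upto (n m : nat) : seq tree :=
  match m with
  | 0 => [::]
  | m'.+1 => [seq Leaf j | j <- iota 0 n] ++
             [seq Node l r | l <- trees_upto n m', r <- trees_upto n m']
  end.

(* T_n, each non-planar tree listed once (a tree with n leaves has height
   at most n - 1, so trees_upto n n contains all of them) *)
Definition Tn (n : nat) : seq tree := undup [seq t <- trees_upto n n | is_Tn n t].

Section Bracket.
Variables (C : pzRingType) (V : lmodType C).
Variables (d : V -> V) (br : V -> V -> V) (h : V -> V).
(* inputs: label j carries a cycle z j representing x_(j+1) in h,
   of degree a j *)
Variables (a : nat -> int) (z : nat -> V).

Definition isnode (t : tree) : int := if t is Node _ _ then 1 else 0.

(* degree of the element carried by the output line of a subtree
   (before applying h) *)
Fixpoint tdeg (t : tree) : int :=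
  match t with
  | Leaf j => a j
  | Node l r => (tdeg l - isnode l) + (tdeg r - isnode r)
  end.

(* value of a subtree: leaves decorated by i (i [z] = pi z), internal lines
   by h, nodes by [[x,y]] = (-1)^|x| [x,y] *)
Fixpoint tval (t : tree) : V :=
  match t with
  | Leaf j => piH d h (z j)
  | Node l r =>
      sgn C (tdeg l - isnode l) *:
        br (if l is Node _ _ then h (tval l) else tval l)
           (if r is Node _ _ then h (tval r) else tval r)
  end.

(* Koszul sign (with shifted parities: |x|+1) of the permutation taking
   (x_1,...,x_n) to the reading order s *)
Definition koszul (s : seq nat) : C :=
  \prod_(p < size s) \prod_(q < size s | (p < q)%N && (nth 0 s q < nth 0 s p)%N)
     sgn C ((a (nth 0 s p) + 1) * (a (nth 0 s q) + 1)).

(* (-1)^(|x_(n-1)| + |x_(n-3)| + ...) *)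
Definition extra_sign (n : nat) : C :=
  \prod_(j < n | (j.+1 <= n.-1)%N && ~~ odd (n.-1 - j.+1)) sgn C (a j).

(* sum over T_n of the tree values, before applying the output projection;
   the bracket {x_1,...,x_n}_h in h is the homology class of
   pi (mm_sum n) *)
Definition mm_sum (n : nat) : V :=
  \sum_(t <- Tn n) (koszul (leaves t) * extra_sign n) *: tval t.

(* representative in im pi of {x_1,...,x_n}_h *)
Definition mm_bracket (n : nat) : V := piH d h (mm_sum n).

End Bracket.

(* Main.v *)
(* Adjoin to g square-zero variables eps_1, ..., eps_n with eps_j of degree
   1 - |x_j|. For a given h, the sums of decorated trees over the proper
   subsets of the inputs are the coefficients of an element phi of total degree
   1 that solves the Maurer-Cartan equation below eps_1...eps_n: acyclicity at
   the intermediate momenta makes h a primitive of each cycle that occurs, and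
   nothing else about h matters. The bracket is the class of the obstruction
   -[phi, phi]/2 at the top monomial. Two such solutions are made equal by
   gauge transformations exp(lam eps_J), taken for increasing |J|: the
   coefficients at J differ by a cycle, hence by some d lam. Each of these
   transformations changes the obstruction by a boundary. *)
Require Import Defs.
From HB Require Import structures.
From mathcomp Require Import all_boot all_order all_algebra.
From mathcomp Require Import complex.
From mathcomp Require Import reals.
From mathcomp Require Import ring.
Set Implicit Arguments.
Unset Strict Implicit.
Unset Printing Implicit Defensive.
Import Order.TTheory GRing.Theory Num.Theory.
Local Open Scope ring_scope.

(** * Signs and linear maps *)

Section Sign.
Variable C : numFieldType.

Lemma sgnE e : sgn C e = (-1) ^ e.
Proof. by case: e => m //; rewrite /exprz invr_sign. Qed.

Lemma sgnD x y : sgn C (x + y) = sgn C x * sgn C y.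
Proof. by rewrite !sgnE expfzDr // oppr_eq0 oner_eq0. Qed.

(** Used for most sign comparisons below: half the difference of the exponents is supplied as [z],
    and [ring] checks the identity in [int]. *)
Lemma sgn_mod2 x y z : x = y + 2 * z -> sgn C x = sgn C y.
Proof. by move=> ->; rewrite mulrDl mul1r !sgnD -expr2 sqrr_sign mulr1. Qed.

Lemma sgn0 : sgn C 0 = 1. Proof. by []. Qed.
Lemma sgn1 : sgn C 1 = -1. Proof. by []. Qed.

Lemma sgn_sum (I : Type) (s : seq I) (P : pred I) (F : I -> int) :
  \prod_(i <- s | P i) sgn C (F i) = sgn C (\sum_(i <- s | P i) F i).
Proof. by rewrite (big_morph _ sgnD sgn0). Qed.
End Sign.

Section IsLinear.
Variables (C : numFieldType) (V : lmodType C) (f : V -> V).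
Hypothesis fL : is_linear f.

Lemma is_linear0 : f 0 = 0.
Proof.
have := fL 1 0 0; rewrite !scale1r addr0 => /eqP.
by rewrite -subr_eq0 opprD addrA subrr sub0r oppr_eq0 => /eqP.
Qed.
Lemma is_linearD u v : f (u + v) = f u + f v.
Proof. by rewrite -[u]scale1r fL !scale1r. Qed.
Lemma is_linearZ c u : f (c *: u) = c *: f u.
Proof. by rewrite -[c *: u]addr0 fL is_linear0 addr0. Qed.
Lemma is_linearN u : f (- u) = - f u.
Proof. by rewrite -!scaleN1r is_linearZ. Qed.
Lemma is_linearB u v : f (u - v) = f u - f v.
Proof. by rewrite is_linearD is_linearN. Qed.
Lemma is_linear_sum (I : Type) (s : seq I) (P : pred I) (F : I -> V) :
  f (\sum_(i <- s | P i) F i) = \sum_(i <- s | P i) f (F i).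
Proof. exact: (big_morph _ is_linearD is_linear0). Qed.
End IsLinear.

(** * The bracket extended by square-zero variables *)

Section Dgla.
Variables (C : numFieldType) (K : zmodType) (V : lmodType C).
Variables (d : V -> V) (br : V -> V -> V) (pr : int -> K -> V -> V).
Hypothesis dg : is_momentum_dgla d br pr.

Lemma pr_linear i k : is_linear (pr i k). Proof. by case: dg. Qed.
Lemma d_linear : is_linear d. Proof. by case: dg => _ _ _ []. Qed.
Lemma d_bihom i k v : bihom pr i k v -> bihom pr (i + 1) k (d v).
Proof. by case: dg => _ _ _ [_ + _] _; apply. Qed.
Lemma d_d v : d (d v) = 0. Proof. by case: dg => _ _ _ []. Qed.
Lemma br_linearl z : is_linear (br ^~ z).
Proof. by case: dg => _ _ _ _ [[H _] *] c x y; exact: H. Qed.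
Lemma br_linearr z : is_linear (br z).
Proof. by case: dg => _ _ _ _ [[_ H] *] c x y; exact: H. Qed.
Lemma br_bihom i k j l x y :
  bihom pr i k x -> bihom pr j l y -> bihom pr (i + j) (k + l) (br x y).
Proof. by case: dg => _ _ _ _ [_ + _ _ _]; apply. Qed.
Lemma br_anti i k j l x y : bihom pr i k x -> bihom pr j l y ->
  br x y = - (sgn C (i * j) *: br y x).
Proof. by case: dg => _ _ _ _ [_ _ + _ _]; apply. Qed.
Lemma br_jacobi i k j l m q x y z :
  bihom pr i k x -> bihom pr j l y -> bihom pr m q z ->
  br x (br y z) = br (br x y) z + sgn C (i * j) *: br y (br x z).
Proof. by case: dg => _ _ _ _ [_ _ _ + _]; apply. Qed.
Lemma d_br i k j l x y : bihom pr i k x -> bihom pr j l y ->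
  d (br x y) = br (d x) y + sgn C i *: br x (d y).
Proof. by case: dg => _ _ _ _ [_ _ _ _]; apply. Qed.

Lemma br0l y : br 0 y = 0. Proof. exact: (is_linear0 (br_linearl y)). Qed.
Lemma br0r y : br y 0 = 0. Proof. exact: (is_linear0 (br_linearr y)). Qed.

Lemma bihom0 i k : bihom pr i k 0. Proof. exact: (is_linear0 (pr_linear i k)). Qed.
Lemma bihomD i k x y : bihom pr i k x -> bihom pr i k y -> bihom pr i k (x + y).
Proof. by rewrite /bihom (is_linearD (pr_linear i k)) => -> ->. Qed.
Lemma bihomZ i k c x : bihom pr i k x -> bihom pr i k (c *: x).
Proof. by rewrite /bihom (is_linearZ (pr_linear i k)) => ->. Qed.
Lemma bihomN i k x : bihom pr i k x -> bihom pr i k (- x).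
Proof. by rewrite -scaleN1r; apply: bihomZ. Qed.
Lemma bihom_sum i k (I : Type) (s : seq I) (P : pred I) (F : I -> V) :
  (forall j, P j -> bihom pr i k (F j)) -> bihom pr i k (\sum_(j <- s | P j) F j).
Proof. by move=> H; apply: big_ind => //; [exact: bihom0 | exact: bihomD]. Qed.

Variables (n : nat) (k : nat -> K) (a : nat -> int).
Implicit Types (A B J : {set 'I_n}) (phi psi chi : {set 'I_n} -> V).

(* The degree of the monomial [eps_A]. *)
Definition edeg A : int := \sum_(i in A) (1 - a i).
Definition mom A : K := \sum_(i in A) k i.
Definition inv_deg A B : int :=
  \sum_(i in A) \sum_(j in B | (j < i)%N) (1 - a i) * (1 - a j).


Lemma sum_setID (W : zmodType) (F : 'I_n -> W) A J : A \subset J ->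
  \sum_(i in J) F i = \sum_(i in A) F i + \sum_(i in J :\: A) F i.
Proof. by move=> AJ; rewrite (big_setID A) /= (setIidPr AJ). Qed.

Lemma edegID A J : A \subset J -> edeg J = edeg A + edeg (J :\: A).
Proof. exact: sum_setID. Qed.

Lemma momID A J : A \subset J -> mom J = mom A + mom (J :\: A).
Proof. exact: sum_setID. Qed.

Lemma inv_degIDl A J B : A \subset J ->
  inv_deg J B = inv_deg A B + inv_deg (J :\: A) B.
Proof. exact: sum_setID. Qed.

Lemma inv_degIDr A J B : A \subset J ->
  inv_deg B J = inv_deg B A + inv_deg B (J :\: A).
Proof.
move=> AJ; rewrite /inv_deg -big_split; apply: eq_bigr => i _.
by rewrite !big_mkcondr; exact: sum_setID.
Qed.

Lemma disjoint_setDr A J : [disjoint A & J :\: A].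
Proof. by rewrite disjoint_sym disjoints_subset setDE subsetIr. Qed.

(** Disjointness excludes [i = j], so each pair of indices is counted once. In [ebr], moving [eps_A]
    past [psi B] costs the exponent [edeg A * (u - edeg B)] and sorting [eps_A eps_B] costs
    [inv_deg B A]; modulo 2 their sum is [u * edeg A + inv_deg A B] by this identity. *)
Lemma inv_deg_swap A B : [disjoint A & B] ->
  inv_deg A B + inv_deg B A = edeg A * edeg B.
Proof.
move=> AB; rewrite /edeg mulr_suml.
have -> : inv_deg B A =
    \sum_(i in A) \sum_(j in B | (i < j)%N) (1 - a j) * (1 - a i).
  rewrite /inv_deg (exchange_big_dep (mem A)) /= => [|i j _ /andP[] //].
  by apply: eq_bigr => i Ai; apply: eq_bigl => j; rewrite Ai.
rewrite -big_split; apply: eq_bigr => i Ai /=.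
rewrite mulr_sumr [RHS](bigID (fun j : 'I_n => (j < i)%N)) /=.
congr (_ + _); apply: eq_big => [j|j _]; last exact: mulrC.
have [Bj|//] := boolP (j \in B); rewrite /= -leqNgt ltn_neqAle.
by case: eqP => // /val_inj ij; rewrite -ij (disjointFr AB Ai) in Bj.
Qed.

(* The bracket of [g (x) C[eps_0, ..., eps_(n-1)]], where [eps_j] has degree
   [1 - a j] and square zero, and [phi] stands for [sum_A phi A eps_A]; the
   integer [u] is the total degree of [psi]. The monomial [eps_A] lists its
   factors by decreasing index, which accounts for [inv_deg]. *)
Definition ebr (u : int) phi psi J : V :=
  \sum_(A : {set 'I_n} | A \subset J)
    sgn C (u * edeg A + inv_deg A (J :\: A)) *: br (phi A) (psi (J :\: A)).

Definition homog (t : int) phi := forall A, bihom pr (t - edeg A) (mom A) (phi A).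

Lemma homog_ebr t u phi psi :
  homog t phi -> homog u psi -> homog (t + u) (ebr u phi psi).
Proof.
move=> hp hq J; apply: bihom_sum => A AJ; apply: bihomZ.
rewrite (edegID AJ) (momID AJ).
have -> : t + u - (edeg A + edeg (J :\: A)) = (t - edeg A) + (u - edeg (J :\: A)) by ring.
exact: br_bihom.
Qed.

Lemma homog_d t phi : homog t phi -> homog (t + 1) (d \o phi).
Proof.
move=> hp A; have -> : t + 1 - edeg A = t - edeg A + 1 by ring.
exact/d_bihom/hp.
Qed.

Lemma homogD t phi psi :
  homog t phi -> homog t psi -> homog t (fun A => phi A + psi A).
Proof. by move=> hp hq A; apply: bihomD. Qed.

Lemma homogN t phi : homog t phi -> homog t (fun A => - phi A).
Proof. by move=> hp A; apply: bihomN. Qed.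

Lemma eq_ebr u phi phi' psi psi' J :
  (forall A, A \subset J -> br (phi A) (psi (J :\: A)) = br (phi' A) (psi' (J :\: A))) ->
  ebr u phi psi J = ebr u phi' psi' J.
Proof. by move=> H; apply: eq_bigr => A AJ; rewrite H. Qed.

Lemma ebrDl u phi phi' psi J :
  ebr u (fun A => phi A + phi' A) psi J = ebr u phi psi J + ebr u phi' psi J.
Proof.
rewrite /ebr -big_split; apply: eq_bigr => A _.
by rewrite (is_linearD (br_linearl _)) scalerDr.
Qed.

Lemma ebrDr u phi psi psi' J :
  ebr u phi (fun A => psi A + psi' A) J = ebr u phi psi J + ebr u phi psi' J.
Proof.
rewrite /ebr -big_split; apply: eq_bigr => A _.
by rewrite (is_linearD (br_linearr _)) scalerDr.
Qed.

Lemma ebrZl u c phi psi J : ebr u (fun A => c *: phi A) psi J = c *: ebr u phi psi J.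
Proof.
rewrite /ebr scaler_sumr; apply: eq_bigr => A _.
by rewrite (is_linearZ (br_linearl _)) !scalerA mulrC.
Qed.

Lemma ebrZr u c phi psi J : ebr u phi (fun A => c *: psi A) J = c *: ebr u phi psi J.
Proof.
rewrite /ebr scaler_sumr; apply: eq_bigr => A _.
by rewrite (is_linearZ (br_linearr _)) !scalerA mulrC.
Qed.

Lemma ebr_anti t u phi psi J : homog t phi -> homog u psi ->
  ebr u phi psi J = - (sgn C (t * u) *: ebr t psi phi J).
Proof.
move=> hp hq; rewrite /ebr scaler_sumr -sumrN.
(* Exchanging the two arguments replaces each subset by its complement in [J]. *)
rewrite (reindex_onto (fun A => J :\: A) (fun A => J :\: A)) /=; last first.
  by move=> A AJ; rewrite setDDr setDv set0U (setIidPr AJ).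
apply: eq_big => [A|A /andP[_ /eqP JA]].
  rewrite subsetDl /=; apply/eqP/idP => [<-|/setIidPr AJ]; first exact: subsetDl.
  by rewrite setDDr setDv set0U.
have AJ : A \subset J by rewrite -JA subsetDl.
rewrite JA (br_anti (hp _) (hq _)) scalerN !scalerA -!sgnD; congr (- (_ *: _)).
have swap := inv_deg_swap (disjoint_setDr A J).
apply: (@sgn_mod2 _ _ _ (inv_deg (J :\: A) A - t * edeg A)).
by rewrite -[inv_deg A _](addrK (inv_deg (J :\: A) A)) swap; ring.
Qed.

(** [d] acts on coefficients from the left and crosses no [eps_j]. The shift to [u + 1] is the
    degree of [d psi]; it absorbs the [edeg A] of the Leibniz sign. *)
Lemma d_ebr t u phi psi J : homog t phi -> homog u psi ->
  d (ebr u phi psi J) = ebr u (d \o phi) psi J + sgn C t *: ebr (u + 1) phi (d \o psi) J.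
Proof.
move=> hp hq; rewrite (is_linear_sum d_linear) /ebr scaler_sumr -big_split.
apply: eq_bigr => A AJ /=.
rewrite (is_linearZ d_linear) (d_br (hp _) (hq _)) scalerDr !scalerA -!sgnD.
congr (_ + _ *: _); apply: (@sgn_mod2 _ _ _ (- edeg A)); ring.
Qed.

Lemma ebr_jacobi t u v phi psi chi J :
  homog t phi -> homog u psi -> homog v chi ->
  ebr (u + v) phi (ebr v psi chi) J =
  ebr v (ebr u phi psi) chi J + sgn C (t * u) *: ebr (t + v) psi (ebr v phi chi) J.
Proof.
move=> hp hq hr.
(* Both nested brackets on the right become sums over disjoint [A], [B] inside [J], with [chi] at
   the rest, to be matched term by term with the Jacobi identity of [br]. *)
have -> : ebr v (ebr u phi psi) chi J = \sum_(A : {set 'I_n} | A \subset J)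
    \sum_(B : {set 'I_n} | B \subset J :\: A)
    sgn C (v * edeg (A :|: B) + inv_deg (A :|: B) (J :\: (A :|: B))
             + (u * edeg A + inv_deg A B))
      *: br (br (phi A) (psi B)) (chi (J :\: (A :|: B))).
  transitivity (\sum_(X : {set 'I_n} | X \subset J) \sum_(A : {set 'I_n} | A \subset X)
    sgn C (v * edeg X + inv_deg X (J :\: X) + (u * edeg A + inv_deg A (X :\: A)))
      *: br (br (phi A) (psi (X :\: A))) (chi (J :\: X))).
    apply: eq_bigr => X _; rewrite (is_linear_sum (br_linearl _)) scaler_sumr.
    by apply: eq_bigr => A _; rewrite (is_linearZ (br_linearl _)) scalerA -sgnD.
  rewrite (exchange_big_dep (fun A => A \subset J)) /= => [|X A XJ AX];
    last exact: subset_trans XJ.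
  apply: eq_bigr => A AJ.
  rewrite (reindex_onto (fun B => A :|: B) (fun X => X :\: A)) /=; last first.
    by move=> X /andP[_ /setIidPr AX]; rewrite -{1}AX setID.
  apply: eq_big => [B|B /andP[_ /eqP->]//].
  rewrite subUset AJ subsetUl andbT /= subsetD; congr (_ && _).
  by rewrite setDUl setDv set0U; apply/eqP/idP => [<-|/setDidPl//];
    rewrite disjoint_sym disjoint_setDr.
have -> : ebr (t + v) psi (ebr v phi chi) J = \sum_(A : {set 'I_n} | A \subset J)
    \sum_(B : {set 'I_n} | B \subset J :\: A)
    sgn C ((t + v) * edeg B + inv_deg B (J :\: B)
             + (v * edeg A + inv_deg A (J :\: (A :|: B))))
      *: br (psi B) (br (phi A) (chi (J :\: (A :|: B)))).
  transitivity (\sum_(B : {set 'I_n} | B \subset J) \sum_(A : {set 'I_n} | A \subset J :\: B)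
    sgn C ((t + v) * edeg B + inv_deg B (J :\: B)
             + (v * edeg A + inv_deg A (J :\: (A :|: B))))
      *: br (psi B) (br (phi A) (chi (J :\: (A :|: B))))).
    apply: eq_bigr => B _; rewrite (is_linear_sum (br_linearr _)) scaler_sumr.
    by apply: eq_bigr => A _; rewrite (is_linearZ (br_linearr _)) scalerA -sgnD setDDl setUC.
  rewrite (exchange_big_dep (fun A => A \subset J)) /= => [|X A XJ AX];
    last exact: subset_trans AX (subsetDl _ _).
  apply: eq_bigr => A AJ; apply: eq_bigl => B.
  by rewrite !subsetD AJ disjoint_sym.
rewrite scaler_sumr -big_split; apply: eq_bigr => A AJ /=.
rewrite (is_linear_sum (br_linearr _)) !scaler_sumr -big_split; apply: eq_bigr => B BJA /=.
have -> : J :\: A :\: B = J :\: (A :|: B) by rewrite setDDl.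
rewrite (is_linearZ (br_linearr _)) (br_jacobi (hp _) (hq _) (hr _)) !scalerDr !scalerA -!sgnD.
have AB : [disjoint A & B] by move: BJA; rewrite subsetD disjoint_sym => /andP[].
have BJ : B \subset J := subset_trans BJA (subsetDl _ _).
have swap := inv_deg_swap AB.
have UJ : A :|: B \subset J by rewrite subUset AJ.
have DU : (A :|: B) :\: A = B.
  by rewrite setDUl setDv set0U; apply/setDidPl; rewrite disjoint_sym.
have DA : J :\: B :\: A = J :\: (A :|: B) by rewrite setDDl setUC.
have AJB : A \subset J :\: B by rewrite subsetD AJ.
rewrite (edegID (subsetUl A B)) (inv_degIDl _ (subsetUl A B)) DU.
rewrite (inv_degIDr A BJA) (inv_degIDr B AJB) setDDl DA.
congr (_ *: _ + _ *: _).
  by apply: (@sgn_mod2 _ _ _ 0); ring.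
apply: (@sgn_mod2 _ _ _ (inv_deg A B - t * edeg B)).
by rewrite -[inv_deg B A](addrK (inv_deg A B)) [inv_deg B A + _]addrC swap; ring.
Qed.

(** * Maurer-Cartan equation and gauge transformations *)

Lemma scale_half_add (x : V) : 2^-1 *: (x + x) = x.
Proof. by rewrite -mulr2n -scaler_nat scalerA mulVf ?pnatr_eq0 // scale1r. Qed.

Definition curv phi A : V := d (phi A) + 2^-1 *: ebr 1 phi phi A.

(** In odd total degree the Jacobi identity reads [3 [[phi, phi], phi] = 0], and 3 is invertible. *)
Lemma ebr_self_jacobi phi J : homog 1 phi -> ebr 1 (ebr 1 phi phi) phi J = 0.
Proof.
move=> hp; have hpp := homog_ebr hp hp.
have := ebr_jacobi J hp hp hp; rewrite (ebr_anti J hp hpp).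
have -> : sgn C (1 * (1 + 1)) = 1 by rewrite /sgn -signr_odd.
have -> : sgn C (1 * 1) = -1 by [].
set X := ebr _ _ _ _; rewrite scale1r scaleN1r opprK => /eqP.
rewrite eq_sym -subr_eq0 opprK -!mulr2n -mulrSr -scaler_nat scaler_eq0 pnatr_eq0.
by move/eqP.
Qed.

(** A Bianchi identity. By Leibniz and antisymmetry [d [phi, phi] = 2 [d phi, phi]]; on proper
    subsets flatness turns [d phi] into [- [phi, phi] / 2], and the coefficient at [J] itself only
    meets [phi set0 = 0]. *)
Lemma d_ebr_self phi J : homog 1 phi -> phi set0 = 0 ->
  (forall A, A \proper J -> curv phi A = 0) -> d (ebr 1 phi phi J) = 0.
Proof.
move=> hp p0 flat; have hdp := homog_d hp.
rewrite (d_ebr J hp hp) (ebr_anti J hp hdp).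
have -> : sgn C (1 * (1 + 1)) = 1 by rewrite /sgn -signr_odd.
rewrite sgn1 scale1r scaleN1r opprK.
suff -> : ebr 1 (d \o phi) phi J = 0 by rewrite addr0.
rewrite (@eq_ebr 1 _ (fun A => - 2^-1 *: ebr 1 phi phi A) phi phi).
  by rewrite ebrZl ebr_self_jacobi // scaler0.
move=> A; rewrite subEproper => /predU1P[->|/flat]; first by rewrite setDv p0 !br0r.
by move/eqP; rewrite addr_eq0 /= => /eqP->; rewrite scaleNr.
Qed.

Definition single J (lam : V) A : V := if A == J then lam else 0.

Lemma homog_single t J lam :
  bihom pr (t - edeg J) (mom J) lam -> homog t (single J lam).
Proof. by move=> hl A; rewrite /single; case: eqP => [->//|_]; apply: bihom0. Qed.

Lemma ebr_single u J lam psi A : ~~ (J \subset A) -> ebr u (single J lam) psi A = 0.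
Proof.
move=> JA; apply: big1 => B BA; rewrite /single.
by case: eqP BA JA => [->->//|*]; rewrite br0l scaler0.
Qed.

(** This is [eps_J ^ 2 = 0]: both arguments are multiples of [eps_J], and an index of [J] cannot lie
    in both [B] and [A :\: B]. *)
Lemma ebr_disjoint_supp u J phi psi A : J != set0 ->
  (forall A, ~~ (J \subset A) -> phi A = 0) ->
  (forall A, ~~ (J \subset A) -> psi A = 0) -> ebr u phi psi A = 0.
Proof.
case/set0Pn=> j Jj hp hq; apply: big1 => B BA.
have [/subsetP/(_ j Jj) Bj|/hp->] := boolP (J \subset B); last by rewrite br0l scaler0.
rewrite [psi _]hq ?br0r ?scaler0 //.
by apply/negP => /subsetP/(_ j Jj); rewrite inE Bj.
Qed.

(* The action of [exp (lam eps_J)]; it is affine since [eps_J] has square zero. *)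
Definition gauge J lam phi A : V :=
  phi A + (d (single J lam A) - ebr 1 (single J lam) phi A).

Lemma gauge_out J lam phi A : ~~ (J \subset A) -> gauge J lam phi A = phi A.
Proof.
move=> JA; rewrite /gauge ebr_single // /single.
by case: eqP JA => [->|_ _]; rewrite ?subxx // (is_linear0 d_linear) subr0 addr0.
Qed.

Lemma homog_gauge J lam phi : homog 1 phi ->
  bihom pr (0 - edeg J) (mom J) lam -> homog 1 (gauge J lam phi).
Proof.
move=> hp /homog_single hl; apply: homogD => //; apply: homogD.
  exact: (homog_d hl).
exact/homogN/(homog_ebr hl hp).
Qed.

(** Covariance of the curvature. The terms quadratic in [lam] vanish by [eps_J ^ 2 = 0]. Of the
    linear ones, [[phi, d lam]] cancels against the Leibniz rule for [d [lam, phi]], and Jacobi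
    gathers the others into a bracket with the curvature. *)
Lemma curv_gauge J lam phi A : J != set0 -> homog 1 phi ->
  bihom pr (0 - edeg J) (mom J) lam ->
  curv (gauge J lam phi) A = curv phi A - ebr (1 + 1) (single J lam) (curv phi) A.
Proof.
move=> J0 hp hl; set L := single J lam; have {}hl : homog 0 L by apply: homog_single.
pose X A := d (L A) - ebr 1 L phi A.
have hX : homog 1 X.
  by apply: homogD; [exact: (homog_d hl) | exact/homogN/(homog_ebr hl hp)].
have XX : ebr 1 X X A = 0.
  have X0 B : ~~ (J \subset B) -> X B = 0.
    by move=> JB; rewrite -[X B](addKr (phi B)) -[_ + X B]/(gauge J lam phi B) gauge_out ?addNr.
  exact: (ebr_disjoint_supp 1 _ J0 X0 X0).
have -> : curv (gauge J lam phi) A = d (phi A + X A) + 2^-1 *: (ebr 1 phi phi A +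
    ebr 1 phi X A + (ebr 1 X phi A + ebr 1 X X A)).
  by rewrite -!ebrDr -ebrDl.
rewrite /curv XX addr0.
rewrite (ebr_anti A hX hp) mulr1 sgn1 scaleN1r opprK -addrA scalerDr scale_half_add.
have -> : ebr 1 phi X A = ebr 1 phi (d \o L) A - ebr 1 phi (ebr 1 L phi) A.
  rewrite -scaleN1r -ebrZr -ebrDr; apply: eq_ebr => B _.
  by rewrite /X scaleN1r.
have -> : d (phi A + X A) = d (phi A) - d (ebr 1 L phi A).
  by rewrite /X !(is_linearD d_linear) d_d (is_linearN d_linear) add0r.
rewrite (d_ebr A hl hp) sgn0 scale1r.
have -> : ebr 1 phi (d \o L) A = ebr 1 (d \o L) phi A.
  by rewrite (ebr_anti A hp (homog_d hl)) scaleN1r opprK.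
have -> : ebr (1 + 1) L (curv phi) A =
    ebr (1 + 1) L (d \o phi) A + ebr 1 phi (ebr 1 L phi) A.
  rewrite /curv ebrDr ebrZr (ebr_jacobi A hl hp hp) scale1r.
  by rewrite (ebr_anti A (homog_ebr hl hp) hp) scaleN1r opprK scale_half_add.
rewrite !opprD.
set x := d _; set y := ebr 1 (d \o L) phi A; set z := ebr (1 + 1) _ _ _.
set w := _ *: _; set u := ebr 1 phi _ _.
by rewrite addrACA; congr (_ + _); rewrite addrACA addNr add0r.
Qed.

(** Flatness stops below [setT], where the obstruction lives. *)
Definition is_mc phi :=
  [/\ homog 1 phi, phi set0 = 0 & forall A, A != setT -> curv phi A = 0].

(** The correction to the curvature at [A] involves only the curvature at [A :\: J], which is not
    [setT] because [J] is nonempty. *)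
Lemma mc_gauge J lam phi : J != set0 -> bihom pr (0 - edeg J) (mom J) lam ->
  is_mc phi -> is_mc (gauge J lam phi).
Proof.
move=> J0 hl [hp p0 flat]; split; first exact: homog_gauge.
  by rewrite gauge_out // subset0.
move=> A AT; rewrite curv_gauge // flat // sub0r; apply/eqP; rewrite oppr_eq0; apply/eqP.
apply: big1 => B BA; rewrite /single; case: eqP => [BJ|_]; last by rewrite br0l scaler0.
rewrite flat ?br0r ?scaler0 //; apply: contraNneq J0 => AB.
move: (disjoint_setDr B A); rewrite AB -BJ disjoints_subset setCT subset0.
by move/eqP->.
Qed.

(** For the same reason the curvature at [setT] is unchanged, so the change of [[phi, phi]] there is
    minus twice the change of [d (phi setT)]. *)
Lemma ebr_self_gauge J lam phi : J != set0 -> bihom pr (0 - edeg J) (mom J) lam ->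
  is_mc phi -> exists w,
  ebr 1 (gauge J lam phi) (gauge J lam phi) setT - ebr 1 phi phi setT = d w.
Proof.
move=> J0 hl [hp p0 flat]; set phi' := gauge J lam phi.
have : curv phi' setT = curv phi setT.
  rewrite curv_gauge // -[RHS]subr0; congr (_ - _); apply: big1 => B _.
  rewrite /single; case: eqP => [->|_]; last by rewrite br0l scaler0.
  rewrite flat ?br0r ?scaler0 // setTD; apply: contraNneq J0 => JT.
  by rewrite -[J]setCK JT setCT.
rewrite /curv => /(canRL (addKr _)) E.
exists (2 *: (phi setT - phi' setT)).
rewrite (is_linearZ d_linear) (is_linearB d_linear).
have {E} : 2^-1 *: ebr 1 phi' phi' setT - 2^-1 *: ebr 1 phi phi setT =
   d (phi setT) - d (phi' setT) by rewrite E addrA addrK addrC.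
move=> <-; rewrite -scalerBr scalerA mulfV ?scale1r // pnatr_eq0 //.
Qed.

(** * Uniqueness of the obstruction class *)

Hypothesis acyc : forall J, (1 < #|J| < n)%N -> acyclic_at d pr (mom J).

(* The gauge transformation at [J] makes the two systems agree at [J] and only
   disturbs them above [J]. *)
Lemma mc_obstruction phi phi' : is_mc phi -> is_mc phi' ->
  (forall j, exists2 lam, bihom pr (0 - edeg [set j]) (mom [set j]) lam &
     phi' [set j] - phi [set j] = d lam) ->
  exists w, ebr 1 phi' phi' setT - ebr 1 phi phi setT = d w.
Proof.
move=> mc mc'; case: (mc') => hp' p0' flat'.
pose le A B := (#|A| <= #|B|)%N.
(* [s] lists the subsets still to be treated, by increasing cardinality; off [s] the coefficients
   already agree, except perhaps at [setT]. *)
have: exists s, [/\ pairwise le s, (forall A B, A \notin s -> B \in s -> le A B) &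
     (forall A, A \notin s -> A != setT -> phi A = phi' A)].
  exists (sort le (enum {: {set 'I_n}})); split=> [|A|A].
  - rewrite -sorted_pairwise; last by move=> B A D; apply: leq_trans.
    by apply: sort_sorted => A B; apply: leq_total.
  - by rewrite mem_sort mem_enum.
  - by rewrite mem_sort mem_enum.
case=> s []; elim: s phi mc => [|J s IH] phi mc; case: (mc) => hp p0 flat.
  (* The brackets at [setT] now coincide: the coefficient at [setT], where agreement is unknown, is
     paired only with the zero coefficient at [set0]. *)
  move=> _ _ agree _; exists 0; rewrite (is_linear0 d_linear).
  apply/eqP; rewrite subr_eq0; apply/eqP/eq_ebr => A _.
  have [->|A0] := eqVneq A set0; first by rewrite p0 p0' !br0l.
  have [->|AT] := eqVneq A setT; first by rewrite setDv p0 p0' !br0r.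
  rewrite (agree A) // (agree (setT :\: A)) //; apply: contraNneq A0 => AT'.
  by rewrite -[A]setCK -[~: A]setTD AT' setCT.
case/andP=> /allP Js srt low agree sing.
have low' A B : A \notin s -> B \in s -> le A B.
  move=> As Bs; have [->|AJ] := eqVneq A J; first exact: Js.
  by apply: low; rewrite inE ?(negPf AJ) // Bs orbT.
have [J0|J0] := eqVneq J set0.
  apply: IH => // A As AT; have [->|AJ] := eqVneq A J; first by rewrite J0 p0 p0'.
  by apply: agree => //; rewrite inE (negPf AJ).
have [JT|JT] := eqVneq J setT.
  apply: IH => // A As AT; have AJ : A != J by rewrite JT.
  by apply: agree => //; rewrite inE (negPf AJ).
have [lam hl dlam] : exists2 lam, bihom pr (0 - edeg J) (mom J) lam &
    phi' J - phi J = d lam.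
  have [/cards1P[j ->]|J1] := boolP (#|J| == 1%N); first exact: sing.
  have J2 : (1 < #|J| < n)%N.
    rewrite ltn_neqAle eq_sym J1 card_gt0 J0 /= -[X in (_ < X)%N]card_ord -cardsT.
    by apply: proper_card; rewrite properEneq JT subsetT.
  have [] := acyc J2 (i := 1 - edeg J) (v := phi' J - phi J).
  - by apply: bihomD; [exact: hp' | exact/bihomN/hp].
  (* Both curvatures vanish at [J], and their quadratic parts agree because they involve proper
     subsets only; so the difference of the coefficients is a cycle. *)
  - rewrite (is_linearB d_linear); apply/eqP; rewrite subr_eq0; apply/eqP.
    apply: (addIr (2^-1 *: ebr 1 phi phi J)); rewrite [RHS]flat //.
    rewrite -[RHS](flat' J JT); congr (_ + _ *: _); apply: eq_ebr => A.
    have agr B : B \proper J -> phi B = phi' B.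
      move=> BJ; apply: agree;
        last by apply: contraTneq BJ => ->; rewrite properE subsetT andbF.
      rewrite inE negb_or; apply/andP; split;
        first by apply: contraTneq BJ => ->; rewrite properxx.
      by apply/negP => /Js; rewrite /le leqNgt proper_card.
    rewrite subEproper => /predU1P[->|AJ]; first by rewrite setDv p0 p0' !br0r.
    have [->|A0] := eqVneq A set0; first by rewrite p0 p0' !br0l.
    rewrite !agr //; rewrite properEneq subsetDl andbT; apply: contraNneq A0 => E.
    by move: (disjoint_setDr A J); rewrite E -setI_eq0 (setIidPl (proper_sub AJ)).
  - move=> w [hw <-]; exists w => //; by have -> : 0 - edeg J = 1 - edeg J - 1 by ring.
have gJ : gauge J lam phi J = phi' J.
  rewrite /gauge {1}/single eqxx -dlam (_ : ebr _ _ _ _ = 0) ?subr0 1?addrC ?subrK //.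
  apply: big1 => B _; rewrite /single; case: eqP => [->|_]; last by rewrite br0l scaler0.
  by rewrite setDv p0 br0r scaler0.
have [||w1 E1] := IH _ (mc_gauge J0 hl mc) srt low'.
(* A set outside [J :: s] has at most [#|J|] elements, hence does not contain [J], and the gauge
   transformation leaves its coefficient alone. *)
- move=> A As AT; have [->//|AJ] := eqVneq A J.
  have As' : A \notin J :: s by rewrite inE negb_or AJ.
  rewrite gauge_out ?agree //; apply: contraNN AJ => JA.
  by rewrite eq_sym eqEcard JA; apply: low => //; apply: mem_head.
- move=> j; have [<-|jJ] := eqVneq J [set j].
    by exists 0; [exact: bihom0 | rewrite gJ subrr (is_linear0 d_linear)].
  rewrite gauge_out ?sing // subset1 negb_or jJ.
  by [].
have [w2 E2] := ebr_self_gauge J0 hl mc.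
by exists (w1 + w2); rewrite (is_linearD d_linear) -E1 -E2 addrA subrK.
Qed.

End Dgla.

(** * Koszul signs of reading orders *)

Section Koszul.
Variables (C : numFieldType) (a : nat -> int).
Local Notation ksg x y := (sgn C ((a x + 1) * (a y + 1))).

Lemma koszul_cons x s :
  koszul C a (x :: s) = (\prod_(y <- s | (y < x)%N) ksg x y) * koszul C a s.
Proof.
rewrite /koszul /= big_ord_recl /=; congr (_ * _).
  rewrite big_mkcond big_ord_recl /= mul1r (big_nth 0%N) big_mkord [RHS]big_mkcond.
  by apply: eq_bigr.
apply: eq_bigr => p _; rewrite big_mkcond big_ord_recl /= mul1r [RHS]big_mkcond.
by apply: eq_bigr.
Qed.

(** An inversion of [s ++ t] lies within [s], within [t], or across the two. *)
Lemma koszul_cat s t : koszul C a (s ++ t) =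
  koszul C a s * koszul C a t * \prod_(x <- s) \prod_(y <- t | (y < x)%N) ksg x y.
Proof.
elim: s => [|x s IH] /=.
  by rewrite big_nil mulr1 {2}/koszul big_ord0 mul1r.
by rewrite !koszul_cons IH big_cat big_cons /=; ring.
Qed.
End Koszul.

(** * Trees with a prescribed set of labels *)

Lemma leaves_gt0 t : (0 < size (leaves t))%N.
Proof. by elim: t => //= l IH r _; rewrite size_cat ltn_addr. Qed.

Lemma minleaf_mem t : minleaf t \in leaves t.
Proof.
elim: t => [j|l IHl r IHr] /=; first exact: mem_head.
by rewrite mem_cat /minn; case: ifP; rewrite ?IHl ?IHr ?orbT.
Qed.

Lemma minleaf_le t j : j \in leaves t -> (minleaf t <= j)%N.
Proof.
elim: t => [i|l IHl r IHr] /=; first by rewrite inE => /eqP->.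
by rewrite mem_cat geq_min => /orP[/IHl->|/IHr->]; rewrite ?orbT.
Qed.

Lemma mem_trees_upto n m t : all (ltn^~ n) (leaves t) ->
  (size (leaves t) <= m)%N -> t \in trees_upto n m.
Proof.
elim: m t => [|m IH] t; first by rewrite leqn0 -leqn0 leqNgt leaves_gt0.
case: t => [j|l r] /=; rewrite mem_cat.
  by rewrite andbT => jn _; rewrite map_f // mem_iota.
rewrite all_cat size_cat => /andP[al ar] sz; apply/orP; right.
have := leaves_gt0 l; have := leaves_gt0 r => r0 l0.
apply/allpairsP; exists (l, r); split=> //; apply: IH => //.
  by rewrite -ltnS (leq_trans _ sz) // -[X in (X < _)%N]addn0 ltn_add2l.
by rewrite -ltnS (leq_trans _ sz) // -[X in (X < _)%N]add0n ltn_add2r.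
Qed.

Section TreesOn.
Variable n : nat.
Implicit Types (A J : {set 'I_n}) (t l r : tree).

Definition set_labels A : seq nat := [seq val i | i <- enum A].
(** [is_Tn] for an arbitrary label set, as needed for subtrees. *)
Definition tree_on A t := perm_eq (leaves t) (set_labels A) && canon t.
Definition trees A := undup [seq t <- trees_upto n n | tree_on A t].
Definition lset t : {set 'I_n} := [set i | val i \in leaves t].

Lemma mem_set_labels A (i : 'I_n) : (val i \in set_labels A) = (i \in A).
Proof. by rewrite mem_map ?mem_enum //; apply: val_inj. Qed.

Lemma uniq_set_labels A : uniq (set_labels A).
Proof. by rewrite map_inj_uniq ?enum_uniq //; apply: val_inj. Qed.

Lemma set_labels_lt A : all (ltn^~ n) (set_labels A).
Proof. by apply/allP => _ /mapP[i _ ->]; apply: ltn_ord. Qed.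

Lemma Tn_trees : Tn n = trees setT.
Proof.
rewrite /Tn /trees; congr undup; apply: eq_filter => t.
by rewrite /is_Tn /tree_on /set_labels enum_setT -enumT val_enum_ord.
Qed.

Lemma mem_trees A t : (t \in trees A) = tree_on A t.
Proof.
rewrite mem_undup mem_filter; case: (boolP (tree_on A t)) => //= /andP[pt _].
apply: mem_trees_upto; first by rewrite (perm_all _ pt) set_labels_lt.
by rewrite (perm_size pt) size_map -cardE -[X in (_ <= X)%N]card_ord max_card.
Qed.

Lemma lsetE A t : tree_on A t -> lset t = A.
Proof. by case/andP=> pt _; apply/setP => i; rewrite inE (perm_mem pt) mem_set_labels. Qed.

Lemma leaves_lset t : uniq (leaves t) -> all (ltn^~ n) (leaves t) ->
  perm_eq (leaves t) (set_labels (lset t)).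
Proof.
move=> ut /allP lt; apply: uniq_perm => // [|x]; first exact: uniq_set_labels.
apply/idP/idP => [xt|/mapP[i + ->]]; last by rewrite mem_enum inE.
by rewrite -[x]/(val (Ordinal (lt _ xt))) mem_set_labels inE.
Qed.

Lemma set_labelsID A J : A \subset J ->
  perm_eq (set_labels A ++ set_labels (J :\: A)) (set_labels J).
Proof.
move=> AJ; rewrite -map_cat perm_map //; apply: uniq_perm => [||i].
- rewrite cat_uniq !enum_uniq andbT /=; apply/hasPn => i.
  by rewrite !mem_enum inE => /andP[].
- exact: enum_uniq.
- rewrite mem_cat !mem_enum inE; case: (boolP (i \in A)) => //= iA.
  by rewrite (subsetP AJ).
Qed.

Variables (J : {set 'I_n}) (i0 : 'I_n).
Hypotheses (i0J : i0 \in J) (i0_min : forall i, i \in J -> (i0 <= i)%N).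

Lemma tree_on_Node A l r : A \subset J -> i0 \in A ->
  tree_on A l -> tree_on (J :\: A) r -> tree_on J (Node l r).
Proof.
move=> AJ i0A /andP[pl cl] /andP[pr cr]; apply/and4P; split=> //.
  exact: perm_trans (perm_cat pl pr) (set_labelsID AJ).
have := minleaf_mem r; rewrite (perm_mem pr) => /mapP[i + ->].
rewrite mem_enum inE => /andP[iA iJ].
have /leq_ltn_trans-> // : (minleaf l <= i0)%N.
  by apply: minleaf_le; rewrite (perm_mem pl) mem_set_labels.
rewrite ltn_neqAle i0_min // andbT; apply: contraNneq iA => i0i.
by rewrite -(val_inj i0i).
Qed.

Lemma tree_on_Node_inv l r : tree_on J (Node l r) ->
  [/\ lset l \subset J, i0 \in lset l, tree_on (lset l) l &
      tree_on (J :\: lset l) r].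
Proof.
case/and4P=> /= plr cl cr lt_lr.
have := uniq_set_labels J; rewrite -(perm_uniq plr) cat_uniq => /and3P[ul dis ur].
have := set_labels_lt J; rewrite -(perm_all _ plr) all_cat => /andP[al ar].
have memJ i : (i \in J) = (val i \in leaves l) || (val i \in leaves r).
  by rewrite -mem_set_labels -(perm_mem plr) mem_cat.
have rE : lset r = J :\: lset l.
  apply/setP => i; rewrite !inE memJ; case: (boolP (_ \in leaves l)) => //= il.
  by apply: contraNF dis => ir; apply/hasP; exists (val i).
split.
- by apply/subsetP => i; rewrite inE memJ => ->.
- move: i0J; rewrite memJ inE => /orP[//|/minleaf_le i0r].
  have := minleaf_mem l => ml; have mn := allP al _ ml.
  have := i0_min (i := Ordinal mn); rewrite memJ /= ml => /(_ isT).
  by move/(leq_ltn_trans)/(_ lt_lr); rewrite ltnNge i0r.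
- by apply/andP; split=> //; apply: leaves_lset.
- by rewrite -rE; apply/andP; split=> //; apply: leaves_lset.
Qed.

(** Cutting at the root. The canonical embedding puts the least label [i0] in the left subtree, so
    requiring [i0 \in A] counts each unordered splitting of [J] once. *)
Lemma sum_trees (W : zmodType) (G : tree -> W) : (1 < #|J|)%N ->
  \sum_(t <- trees J) G t = \sum_(A : {set 'I_n} | (A \subset J) && (i0 \in A))
    \sum_(l <- trees A) \sum_(r <- trees (J :\: A)) G (Node l r).
Proof.
move=> J1; pose left t := if t is Node l _ then lset l else set0.
have nodeJ t : t \in trees J -> exists l r, t = Node l r.
  case: t => [j|l r]; last by exists l, r.
  rewrite mem_trees => /andP[/perm_size /=]; rewrite size_map -cardE => J_1.
  by rewrite -J_1 in J1.
rewrite big_seq (partition_big left (fun A => (A \subset J) && (i0 \in A))) /=; last first.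
  move=> t tJ; have [l [r def_t]] := nodeJ t tJ; move: tJ.
  by rewrite def_t mem_trees => /tree_on_Node_inv[-> ->].
apply: eq_bigr => A /andP[AJ i0A].
rewrite -[RHS](@big_allpairs_dep _ _ _ _ _ _ Node (trees A) (fun=> trees (J :\: A)) G).
rewrite -big_seq_cond -big_filter; apply: perm_big; apply: uniq_perm.
- by rewrite filter_uniq ?undup_uniq.
- by apply: allpairs_uniq; rewrite ?undup_uniq // => -[l r] [l' r'] _ _ [-> ->].
move=> t; rewrite mem_filter; apply/andP/allpairsP => [[/eqP lA tJ]|[[l r] /= [lA rA ->]]].
  have [l [r def_t]] := nodeJ t tJ; move: tJ lA.
  rewrite def_t mem_trees => /tree_on_Node_inv[_ _ tl tr] /= lA.
  by exists (l, r); rewrite /= !mem_trees -lA.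
rewrite !mem_trees in lA rA *; split; first by rewrite /= (lsetE lA).
exact: (@tree_on_Node A).
Qed.
End TreesOn.

(** * Degrees and signs of a tree from its label set *)

Section LabelSums.
Variables (C : numFieldType) (n : nat) (a : nat -> int).
Implicit Types (A B : {set 'I_n}) (t l r : tree).

Lemma big_leaves_cond (R : Type) (idx : R) (op : Monoid.com_law idx) A t
    (P : pred nat) (F : nat -> R) : tree_on A t ->
  \big[op/idx]_(j <- leaves t | P j) F j = \big[op/idx]_(i in A | P (val i)) F (val i).
Proof. by case/andP=> pt _; rewrite (perm_big _ pt) big_map big_enum_cond. Qed.

Lemma big_leaves (R : Type) (idx : R) (op : Monoid.com_law idx) A t (F : nat -> R) :
  tree_on A t -> \big[op/idx]_(j <- leaves t) F j = \big[op/idx]_(i in A) F (val i).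
Proof. by case/andP=> pt _; rewrite (perm_big _ pt) big_map big_enum. Qed.

(** A node adds the degrees of its inputs and the [h] after it subtracts one, as in
    [(1 - x) + (1 - y) - 1 = 1 - (x + y)]. *)
Lemma tdeg_edeg A t : tree_on A t -> tdeg a t - isnode t = 1 - edeg a A.
Proof.
move=> tA; rewrite /edeg -(big_leaves _ (fun j => 1 - a j) tA) => {A tA}.
elim: t => [j|l IHl r IHr] /=; first by rewrite big_seq1; ring.
by rewrite IHl IHr big_cat /=; ring.
Qed.

(** [a x + 1] and [1 - a x] have the same parity, so the shifted Koszul sign of the inputs is the
    sign of sorting the [eps_j]. *)
Lemma cross_sign A B l r : tree_on A l -> tree_on B r ->
  \prod_(x <- leaves l) \prod_(y <- leaves r | (y < x)%N)
    sgn C ((a x + 1) * (a y + 1)) = sgn C (inv_deg a A B).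
Proof.
move=> lA rB; rewrite (big_leaves _ _ lA) /inv_deg -sgn_sum; apply: eq_bigr => i _; rewrite -sgn_sum.
rewrite (big_leaves_cond _ _ _ rB); apply: eq_bigr => j _.
by apply: (@sgn_mod2 _ _ _ (a i + a j)); rewrite /=; ring.
Qed.

Lemma trees_set0 : trees (set0 : {set 'I_n}) = [::].
Proof.
apply/nilP; rewrite /nilp; case E: (trees _) => [//|t s].
have : t \in trees (set0 : {set 'I_n}) by rewrite E mem_head.
rewrite mem_trees => /andP[/perm_size]; rewrite /set_labels enum_set0 /= => sz.
by have := leaves_gt0 t; rewrite sz.
Qed.

Lemma trees_set1 (j : 'I_n) : perm_eq (trees [set j]) [:: Leaf j].
Proof.
apply: uniq_perm; rewrite ?undup_uniq // => t.
rewrite mem_trees inE /tree_on /set_labels enum_set1 /=.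
apply/andP/eqP => [[pt _]|->]; last by rewrite perm_refl.
case: t pt => [i|l r] /=; first by move/perm_mem/(_ i); rewrite !inE eqxx => /esym/eqP->.
move/perm_size; rewrite size_cat /= => sz.
by have := leq_add (leaves_gt0 l) (leaves_gt0 r); rewrite sz.
Qed.
End LabelSums.

(** * The minimal model bracket as an obstruction *)

Section MinimalModel.
Variables (C : numFieldType) (K : zmodType) (V : lmodType C).
Variables (d : V -> V) (br : V -> V -> V) (pr : int -> K -> V -> V).
Hypothesis dg : is_momentum_dgla d br pr.
Variables (n : nat) (k : nat -> K) (a : nat -> int) (z : nat -> V).
Hypothesis z_bihom : forall j, (j < n)%N -> bihom pr (a j) (k j) (z j).
Hypothesis dz : forall j, (j < n)%N -> d (z j) = 0.
Hypothesis acyc : forall J : {set 'I_n}, (1 < #|J| < n)%N -> acyclic_at d pr (mom k J).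
Hypothesis n_gt1 : (1 < n)%N.

Section OneHomotopy.
Variable h : V -> V.
Hypothesis hG : good_homotopy d pr h.
Implicit Types (A J : {set 'I_n}) (t l r : tree).

Let h_linear : is_linear h. Proof. by case: hG. Qed.

Lemma piH_cycle v : d v = 0 -> piH d h v = v - d (h v).
Proof. by move=> dv; rewrite /piH dv (is_linear0 h_linear) subr0. Qed.

Lemma d_piH v : d (piH d h v) = 0.
Proof.
case: hG => _ _ _ _ dhd.
by rewrite /piH !(is_linearB (d_linear dg)) (d_d dg) dhd subr0 subrr.
Qed.

Lemma piH_boundary v : piH d h (d v) = 0.
Proof. by case: hG => _ _ _ _ dhd; rewrite piH_cycle ?(d_d dg) // dhd subrr. Qed.

Lemma piH_bihom i q v : bihom pr i q v -> bihom pr i q (piH d h v).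
Proof.
case: hG => _ hb _ _ _ hv; rewrite /piH.
have E : i = i - 1 + 1 by ring.
have E' : i = i + 1 - 1 by ring.
apply: (bihomD dg); first apply: (bihomD dg) => //.
  by apply: (bihomN dg); rewrite E; apply/(d_bihom dg)/hb.
by apply: (bihomN dg); rewrite E'; apply/hb/(d_bihom dg).
Qed.

Definition hval t : V :=
  if t is Node _ _ then h (Defs.tval d br h a z t) else Defs.tval d br h a z t.

Lemma tval_Node l r : Defs.tval d br h a z (Node l r) =
  sgn C (tdeg a l - isnode l) *: br (hval l) (hval r).
Proof. by []. Qed.

(** The Maurer-Cartan element built from [h]. *)
Definition Phi A : V := \sum_(t <- trees A) koszul C a (leaves t) *: hval t.
Definition tree_sum J : V := \sum_(t <- trees J) koszul C a (leaves t) *: Defs.tval d br h a z t.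

Lemma hval_bihom t : all (ltn^~ n) (leaves t) ->
  bihom pr (tdeg a t - isnode t) (\sum_(j <- leaves t) k j) (hval t).
Proof.
elim: t => [j|l IHl r IHr].
  by rewrite /= andbT subr0 big_seq1 => jn; apply/piH_bihom/z_bihom.
rewrite all_cat => /andP[/IHl hl /IHr hr]; case: hG => _ hb _ _ _.
rewrite -[hval _]/(h (Defs.tval d br h a z (Node l r))); apply: hb;
  rewrite tval_Node; apply: (bihomZ dg).
by rewrite /= big_cat; apply: (br_bihom dg).
Qed.

Lemma homog_Phi : homog pr k a 1 Phi.
Proof.
move=> A; rewrite /Phi big_seq; apply: (bihom_sum dg) => t; rewrite mem_trees => tA.
apply: (bihomZ dg); rewrite -(tdeg_edeg a tA).
have -> : mom k A = \sum_(j <- leaves t) k j.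
  by rewrite (big_leaves _ _ tA).
by apply: hval_bihom; case/andP: tA => pt _; rewrite (perm_all _ pt) set_labels_lt.
Qed.

Lemma Phi_set0 : Phi set0 = 0.
Proof. by rewrite /Phi trees_set0 big_nil. Qed.

Lemma Phi_set1 j : Phi [set j] = piH d h (z j).
Proof.
rewrite /Phi (perm_big _ (trees_set1 j)) big_seq1 koszul_cons big_nil.
by rewrite /koszul big_ord0 mulr1 scale1r.
Qed.

Lemma Phi_tree_sum J : (1 < #|J|)%N -> Phi J = h (tree_sum J).
Proof.
move=> J1; rewrite /tree_sum (is_linear_sum h_linear) /Phi big_seq [RHS]big_seq.
apply: eq_bigr => t; rewrite mem_trees (is_linearZ h_linear) => /andP[/perm_size + _].
by case: t => //= j; rewrite size_map -cardE => E; rewrite -E in J1.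
Qed.

(** In [ebr] the terms of [A] and [J :\: A] are equal by antisymmetry, so half the sum keeps just
    the subsets containing the least label; these are the root splittings of [sum_trees]. *)
Lemma tree_sum_rec J : (1 < #|J|)%N ->
  tree_sum J = - (2^-1 *: ebr br a 1 Phi Phi J).
Proof.
move=> J1; have /card_gt0P[j jJ] : (0 < #|J|)%N by apply: ltnW.
case: (@arg_minnP _ j (fun i => i \in J) val jJ) => i0 i0J i0_min.
pose S A := sgn C (1 * edeg a A + inv_deg a A (J :\: A)) *: br (Phi A) (Phi (J :\: A)).
have -> : ebr br a 1 Phi Phi J =
    \sum_(A : {set 'I_n} | (A \subset J) && (i0 \in A)) (S A + S A).
  rewrite /ebr (bigID (fun A : {set 'I_n} => i0 \in A)) /= big_split /=; congr (_ + _).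
  rewrite (reindex_onto (fun A => J :\: A) (fun A => J :\: A)) /=; last first.
    by move=> A /andP[AJ _]; rewrite setDDr setDv set0U (setIidPr AJ).
  have JDD A : A \subset J -> J :\: (J :\: A) = A.
    by move=> AJ; rewrite setDDr setDv set0U (setIidPr AJ).
  apply: eq_big => [A|A /andP[_ /eqP JA]].
    rewrite subsetDl inE i0J andbT negbK /=;
        have [i0A|] := boolP (i0 \in A); last by rewrite !andbF.
    rewrite !andbT /=; apply/eqP/idP => [<-|/JDD//]; exact: subsetDl.
  rewrite JA (br_anti dg (homog_Phi _) (homog_Phi _)) -scaleNr -mulN1r -sgn1 -sgnD.
  rewrite scalerA -sgnD /S; congr (_ *: _).
  have swap := inv_deg_swap a (disjoint_setDr A J).
  apply: (@sgn_mod2 _ _ _ (inv_deg a (J :\: A) A + 1 - edeg a A)).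
  by rewrite -[inv_deg _ A _](addrK (inv_deg a (J :\: A) A)) swap; ring.
rewrite scaler_sumr /tree_sum (sum_trees i0J i0_min _ J1) -sumrN.
apply: eq_bigr => A /andP[AJ i0A]; rewrite scale_half_add.
rewrite /S {1}/Phi (is_linear_sum (br_linearl dg _)) scaler_sumr -sumrN.
rewrite big_seq [RHS]big_seq; apply: eq_bigr => l; rewrite mem_trees => lA.
rewrite /Phi (is_linear_sum (br_linearr dg _)) scaler_sumr -sumrN.
rewrite big_seq [RHS]big_seq; apply: eq_bigr => r; rewrite mem_trees => rA.
rewrite (is_linearZ (br_linearl dg _)) (is_linearZ (br_linearr dg _)) tval_Node (tdeg_edeg a lA).
rewrite /= koszul_cat (cross_sign C a lA rA) !scalerA -scaleNr; congr (_ *: _).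
(* The sign of [[[x, y]]] at the root, with [|x| = 1 - edeg a A], provides the overall minus. *)
have -> : sgn C (1 - edeg a A) = - sgn C (edeg a A).
  rewrite -[RHS]mulN1r -sgn1 -sgnD; apply: (@sgn_mod2 _ _ _ (- edeg a A)); ring.
by rewrite mul1r sgnD; ring.
Qed.

(** Strong induction on the cardinality. Flatness on proper subsets makes [tree_sum J] a cycle,
    acyclicity makes it a boundary, and [d h] fixes boundaries; hence [d (Phi J) = tree_sum J],
    which cancels the quadratic part. *)
Lemma mc_Phi : is_mc d br pr k a Phi.
Proof.
split; [exact: homog_Phi | exact: Phi_set0 | move=> J].
have [m] := ubnP #|J|; elim: m J => // m IH J; rewrite ltnS => Jm JT.
have [J1|J1] := leqP #|J| 1.
  have dPhi : d (Phi J) = 0.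
    case: (posnP #|J|) => [/eqP|J0]; first
      by rewrite cards_eq0 => /eqP->; rewrite Phi_set0 (is_linear0 (d_linear dg)).
    have /cards1P[j ->] : #|J| == 1%N by rewrite eqn_leq J1.
    by rewrite Phi_set1 d_piH.
  (* With at most one label, one argument of each bracket sits at [set0]. *)
  rewrite /curv dPhi add0r [X in _ *: X](_ : _ = 0) ?scaler0 //; apply: big1 => A AJ.
  have [->|A0] := eqVneq A set0; first by rewrite Phi_set0 (br0l dg) scaler0.
  suff -> : J :\: A = set0 by rewrite Phi_set0 (br0r dg) scaler0.
  apply/eqP; rewrite setD_eq0; suff /eqP-> : A == J by [].
  by rewrite eqEcard AJ (leq_trans J1) // card_gt0.
have J2 : (1 < #|J| < n)%N.
  by rewrite J1 -[X in (_ < X)%N]card_ord -cardsT proper_card // properEneq JT subsetT.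
have dB : d (tree_sum J) = 0.
  rewrite tree_sum_rec // (is_linearN (d_linear dg)) (is_linearZ (d_linear dg)).
  rewrite (d_ebr_self dg homog_Phi Phi_set0) ?scaler0 ?oppr0 // => A AJ.
  apply: IH; first exact: leq_trans (proper_card AJ) Jm.
  by apply: contraTneq AJ => ->; rewrite properE subsetT andbF.
have Bh : bihom pr (1 + 1 - edeg a J) (mom k J) (tree_sum J).
  rewrite tree_sum_rec //; apply/(bihomN dg)/(bihomZ dg).
  exact: (homog_ebr dg homog_Phi homog_Phi).
have [w [_ wB]] := acyc J2 Bh dB.
have := piH_boundary w; rewrite wB piH_cycle // => /eqP; rewrite subr_eq0 => /eqP B_dhB.
by rewrite /curv Phi_tree_sum // -B_dhB tree_sum_rec // addNr.
Qed.

Lemma mm_sum_ebr : mm_sum d br h a z n =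
  extra_sign C a n *: - (2^-1 *: ebr br a 1 Phi Phi setT).
Proof.
rewrite -tree_sum_rec ?cardsT ?card_ord // /mm_sum Tn_trees /tree_sum scaler_sumr.
by apply: eq_bigr => t _; rewrite scalerA mulrC.
Qed.

(** The tree sum is a cycle by [d_ebr_self], and on cycles [piH] only subtracts a boundary. *)
Lemma mm_bracket_ebr : exists w, mm_bracket d br h a z n =
  extra_sign C a n *: - (2^-1 *: ebr br a 1 Phi Phi setT) - d w.
Proof.
exists (h (mm_sum d br h a z n)); rewrite -mm_sum_ebr; apply: piH_cycle.
have [_ p0 flat] := mc_Phi.
rewrite mm_sum_ebr (is_linearZ (d_linear dg)) (is_linearN (d_linear dg)) (is_linearZ (d_linear dg)).
rewrite (d_ebr_self dg homog_Phi p0) ?scaler0 ?oppr0 ?scaler0 // => A AT.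
by apply: flat; apply: contraTneq AT => ->; rewrite properxx.
Qed.
End OneHomotopy.

Lemma mm_bracket_unique h1 h2 : good_homotopy d pr h1 -> good_homotopy d pr h2 ->
  exists w, mm_bracket d br h1 a z n - mm_bracket d br h2 a z n = d w.
Proof.
move=> g1 g2.
have [j|w w12] := mc_obstruction dg acyc (mc_Phi g2) (mc_Phi g1).
  (* On cycles [piH] is [1 - d h], so the leaf values for [h1] and [h2] differ by this boundary. *)
  exists (h2 (z j) - h1 (z j)).
    have zj := z_bihom (ltn_ord j).
    have -> : 0 - edeg a [set j] = a j - 1 by rewrite /edeg big_set1; ring.
    rewrite /mom big_set1; case: g1 g2 => _ hb1 _ _ _ [_ hb2 _ _ _].
    by apply: (bihomD dg); [exact: hb2 | exact/(bihomN dg)/hb1].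
  rewrite !Phi_set1 !piH_cycle ?dz // (is_linearB (d_linear dg)).
  by rewrite opprB addrC addrA subrK.
have [w1 ->] := mm_bracket_ebr g1; have [w2 ->] := mm_bracket_ebr g2.
(* [w] comes from the two obstructions, [w1] and [w2] from the two output projections. *)
exists (extra_sign C a n *: - (2^-1 *: w) - (w1 - w2)).
rewrite !(is_linearB (d_linear dg)) (is_linearZ (d_linear dg)) (is_linearN (d_linear dg)) (is_linearZ (d_linear dg)) -w12.
have -> : forall x1 x2 y1 y2 : V, x1 - y1 - (x2 - y2) = x1 - x2 - (y1 - y2).
  by move=> x1 x2 y1 y2; rewrite !opprB addrACA [RHS]addrACA [- y1 - x2]addrC.
by congr (_ - _); rewrite -scalerBr; congr (_ *: _); rewrite scalerBr opprB opprK addrC.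
Qed.
End MinimalModel.

Local Open Scope complex_scope.

(** Homology classes are handled through representing cycles, so equality of the two brackets reads
    as their difference being a boundary. *)
Theorem mainTheorem1 (R : realType) (K : zmodType) (V : lmodType R[i])
    (d : V -> V) (br : V -> V -> V) (pr : int -> K -> V -> V) :
  is_momentum_dgla d br pr ->
  forall (n : nat) (k : nat -> K), (2 <= n)%N ->
  (forall J : {set 'I_n}, (1 < #|J| < n)%N ->
      acyclic_at d pr (\sum_(j in J) k (nat_of_ord j))) ->
  forall h1 h2 : V -> V, good_homotopy d pr h1 -> good_homotopy d pr h2 ->
  forall (a : nat -> int) (z : nat -> V),
    (forall j, (j < n)%N -> bihom pr (a j) (k j) (z j)) ->
    (forall j, (j < n)%N -> d (z j) = 0) ->
    exists w : V, mm_bracket d br h1 a z n - mm_bracket d br h2 a z n = d w.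
Proof.
move=> dg n k n_gt1 acyc h1 h2 g1 g2 a z z_bihom dz.
exact: (mm_bracket_unique dg z_bihom dz acyc n_gt1 g1 g2).
Qed.
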